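(* Let $\mathcal{T}$ be a trie with $N \ge 1$ edges and $L$ leaves. Then there are exactly $2N-L$ maximal palindromes in $\mathcal{T}$.
   Context: A trie $\mathcal{T}=(V,E)$ is a (finite) rooted tree whose edges are labeled by characters of an alphabet $\Sigma$ so that the out-going edges of every node (the edges to its children) carry pairwise distinct labels. A leaf is a node without children. For a non-root node $u$, $\mathsf{parent}(u)$ is its parent. For nodes $u,v$ such that $u=v$ or $u$ is an ancestor of $v$, $\mathsf{str}(u,v)$ is the concatenation of the edge labels along the downward path from $u$ to $v$ (the empty string $\varepsilon$ if $u=v$). A string is a palindrome if it equals its reversal; $\varepsilon$ is a palindrome. A palindromic path $P=\mathsf{str}(u,v)$ (considered as an occurrence, i.e. identified with the pair $(u,v)$, equivalently with the pair $(|P|,v)$) is a maximal palindrome in $\mathcal{T}$ if one of the following holds: (1) $u\neq v$ and $u$ is the root; (2) $u\neq v$ and $v$ is a leaf; or (3) $u$ is not the root, $v$ is not a leaf, and for every child $v'$ of $v$, $\mathsf{str}(\mathsf{parent}(u),v')$ is not a palindrome. Thus a length-zero maximal palindrome ($u=v$) can occur only at a non-root internal node, while the empty paths at the root and at the leaves are not counted. *)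

(* Defs.v *)
From mathcomp Require Import all_boot.

Set Implicit Arguments.
Unset Strict Implicit.
Unset Printing Implicit Defensive.

(* [edge u v] means that [v] is a child of [u]; [label u v] is meaningful only
   when [edge u v] holds.  The axioms [edge_root], [edge_inj] and [root_connect]
   say that [edge], oriented away from the root, is a finite rooted tree. *)
Record trie (Sigma : eqType) := Trie {
  node : finType;
  root : node;
  edge : rel node;
  label : node -> node -> Sigma;
  edge_root : forall u, ~~ edge u root;
  edge_inj : forall u u' v, edge u v -> edge u' v -> u = u';
  root_connect : forall v, connect edge root v;
  label_inj : forall u v v',
    edge u v -> edge u v' -> label u v = label u v' -> v = v'
}.

Definition palindrome (A : eqType) (s : seq A) : bool := s == rev s.

Section TrieDefs.

Variables (Sigma : eqType) (T : trie Sigma).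
Implicit Types u v : node T.

Definition edges : {set node T * node T} := [set e | edge e.1 e.2].

Definition is_leaf v : bool := [forall w, ~~ edge v w].

Definition leaves : {set node T} := [set v | is_leaf v].

(* Only used at non-root nodes; the value at the root is the root itself. *)
Definition parent u : node T := odflt u [pick w | edge w u].

(* [u = v] or [u] is an ancestor of [v]. *)
Definition anc u v : bool := connect (@edge _ T) u v.

Definition downpath u v : pred (seq (node T)) :=
  fun p => path (@edge _ T) u p && (last u p == v).

Lemma anc_downpath u v : anc u v -> exists p, downpath u v p.
Proof.
by case/connectP=> p ep ->; exists p; rewrite /downpath ep eqxx.
Qed.

(* The labels along the downward path from [u] to [v], which is unique (see
   [strE]); the value is junk when [anc u v] fails. *)
Definition str u v : seq Sigma :=
  if @idP (anc u v) is ReflectT uv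
  then pairmap (@label _ T) u (xchoose (anc_downpath uv)) else [::].

Definition pal_path u v : bool := anc u v && palindrome (str u v).

Definition maximal_palindrome u v : bool :=
  pal_path u v &&
  [|| (u != v) && (u == root T),
      (u != v) && is_leaf v
    | [&& u != root T, ~~ is_leaf v &
          [forall v', edge v v' ==> ~~ palindrome (str (parent u) v')]]].

Definition maximal_palindromes : {set node T * node T} :=
  [set P | maximal_palindrome P.1 P.2].

Lemma parentE u v : edge u v -> parent v = u.
Proof.
rewrite /parent => uv; case: pickP => [w wv|/(_ u)]; last by rewrite uv.
exact: edge_inj wv uv.
Qed.

Lemma root_path_size p : path (@edge _ T) (root T) p ->
  last (root T) p = root T -> p = [::].
Proof.
case/lastP: p => // p x; rewrite rcons_path last_rcons => /andP[_ + xr].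
by rewrite xr (negbTE (edge_root _)).
Qed.

Lemma path_inj x y p q : path (@edge _ T) x p -> path (@edge _ T) y q ->
  last x p = last y q -> size p = size q -> x = y /\ p = q.
Proof.
elim/last_ind: p q => [|p a IHp] q; first by case: q.
case/lastP: q => [|q b]; first by rewrite size_rcons.
rewrite !rcons_path !last_rcons !size_rcons => /andP[xp pa] /andP[yq qb] ab.
subst b => -[spq]; have [-> ->] := IHp _ xp yq (edge_inj pa qb) spq.
by [].
Qed.

Lemma downpath_uniq u v p q : downpath u v p -> downpath u v q -> p = q.
Proof.
move=> /andP[up /eqP pv] /andP[uq /eqP qv].
suff spq : size p = size q by have [] := path_inj up uq (etrans pv (esym qv)) spq.
have /connectP[r rr ru] := root_connect u.
have key s t : path (@edge _ T) u s -> path (@edge _ T) u t ->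
    last u s = last u t -> size s <= size t.
  move=> us ut st; rewrite leqNgt; apply/negP => lt_ts.
  have rs : path (@edge _ T) (root T) (r ++ s) by rewrite cat_path rr -ru.
  have rt : path (@edge _ T) (root T) (r ++ t) by rewrite cat_path rr -ru.
  set n := size s - size t.
  have lt_n : n <= size (r ++ s).
    by rewrite size_cat /n (leq_trans (leq_subr _ _)) // leq_addl.
  have := rs; rewrite -(cat_take_drop n (r ++ s)) cat_path => /andP[rn nd].
  have sd : size (drop n (r ++ s)) = size (r ++ t).
    rewrite size_drop !size_cat /n -addnBA ?leq_subr //.
    by rewrite subKn // ltnW.
  have ld : last (last (root T) (take n (r ++ s))) (drop n (r ++ s))
          = last (root T) (r ++ t).
    by rewrite -last_cat cat_take_drop !last_cat -ru.
  have [r0 _] := path_inj nd rt ld sd.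
  have /(congr1 size) := root_path_size rn r0.
  rewrite size_takel //= => n0; move: lt_ts.
  by rewrite -subn_gt0 -/n n0.
by apply/eqP; rewrite eqn_leq !key // pv qv.
Qed.

Lemma strE u p : path (@edge _ T) u p ->
  str u (last u p) = pairmap (@label _ T) u p.
Proof.
move=> up; have dp : downpath u (last u p) p by rewrite /downpath up eqxx.
rewrite /str; case: {-}_ / idP => [uv|[]]; last by apply/connectP; exists p.
by rewrite (downpath_uniq (xchooseP (anc_downpath uv)) dp).
Qed.

End TrieDefs.

Arguments edges {Sigma} T.
Arguments leaves {Sigma} T.
Arguments maximal_palindromes {Sigma} T.

(* Main.v *)
(** Call a palindromic path admissible if it is nonempty or sits at a non-root
    internal node.  Labels out of a node being distinct, an admissible path
    that is not maximal extends by one edge at both ends to exactly one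
    palindromic path, and this is a bijection onto the palindromic paths of
    length at least two.  So the maximal palindromes are equinumerous with the
    admissible paths of length at most one: the [N] edges and the [N - L]
    non-root internal nodes. *)

From mathcomp Require Import all_boot.
Require Import Defs.

Set Implicit Arguments.
Unset Strict Implicit.
Unset Printing Implicit Defensive.

(** * Palindromes and label strings of downward paths *)

Lemma palindrome_cons_rcons (A : eqType) (a b : A) s :
  palindrome (a :: rcons s b) = (a == b) && palindrome s.
Proof.
rewrite /palindrome rev_cons rev_rcons rcons_cons eqseq_cons eqseq_rcons.
by case: eqVneq => //; rewrite andbT.
Qed.

Section Trie.

Variables (Sigma : eqType) (T : trie Sigma).
Implicit Types u v w : node T.

Lemma edge_parent u : u != root T -> edge (parent u) u.
Proof.
have /connectP[p] := root_connect u; case/lastP: p => [_ ->|p x].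
  by rewrite eqxx.
rewrite rcons_path last_rcons => /andP[_ e] -> _.
by rewrite (parentE e).
Qed.

Lemma edge_neq_root u v : edge u v -> v != root T.
Proof. by apply: contraTneq => ->; apply: edge_root. Qed.

Lemma anc_str u v : anc u v ->
  exists p, [/\ path (@edge _ T) u p, v = last u p
              & str u v = pairmap (@label _ T) u p].
Proof. by case/connectP=> p up ->; exists p; split=> //; apply: strE. Qed.

(** Climbing from [v] is deterministic, parents being unique, so the number of steps fixes where the
    climb ends. *)
Lemma anc_inj u u' v : anc u v -> anc u' v ->
  size (str u v) = size (str u' v) -> u = u'.
Proof.
case/anc_str=> p [up vp ->] /anc_str[q [uq vq ->]]; rewrite !size_pairmap.
by move=> spq; have [] := path_inj up uq (etrans (esym vp) vq) spq.
Qed.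

Lemma str_refl u : str u u = [::].
Proof. exact: (@strE _ T u [::]). Qed.

Lemma str_edge u v : edge u v -> str u v = [:: label u v].
Proof. by move=> uv; apply: (@strE _ T u [:: v]); rewrite /= uv. Qed.

Lemma str_extend w u v v' : edge w u -> anc u v -> edge v v' ->
  str w v' = label w u :: rcons (str u v) (label v v').
Proof.
move=> wu /anc_str[p [up vp ->]] vv'.
have wp : path (@edge _ T) w (u :: rcons p v') by rewrite /= wu rcons_path up -vp.
have:= strE wp; rewrite /= last_rcons => ->.
by rewrite -!cats1 pairmap_cat /= -vp.
Qed.

Lemma anc_extend w u v v' : edge w u -> anc u v -> edge v v' -> anc w v'.
Proof.
move=> wu uv vv'; apply: connect_trans (connect1 wu) _.
exact: connect_trans uv (connect1 vv').
Qed.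

Lemma anc_size_gt1 x y : anc x y -> 1 < size (str x y) ->
  exists u v, [/\ edge x u, anc u v & edge v y].
Proof.
case/anc_str=> -[|u p] [xp -> ->] //; case/lastP: p xp => // p y'.
rewrite /= rcons_path last_rcons => /and3P[xu up vy] _.
by exists u, (last u p); split=> //; apply/connectP; exists p.
Qed.

Lemma anc_size_le1 u v : anc u v -> size (str u v) <= 1 ->
  (u == v) || edge u v.
Proof.
case/anc_str=> -[|x [|y p]] [up -> ->] //=; first by rewrite eqxx.
by move: up; rewrite /= andbT => ->; rewrite orbT.
Qed.

(** * Counting nodes *)

Lemma root_not_leaf : 0 < #|edges T| -> ~~ is_leaf (root T).
Proof.
case/card_gt0P=> -[u v]; rewrite inE /= => uv.
have /connectP[[|x p] /=] := root_connect v.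
  by move=> _ vr; have:= edge_neq_root uv; rewrite vr eqxx.
by case/andP=> rx _ _; apply/negP => /forallP/(_ x); rewrite rx.
Qed.

(** Sending an edge to its lower end is a bijection onto the non-root nodes. *)
Lemma card_nodes : #|node T| = #|edges T|.+1.
Proof.
have inj : {in edges T &, injective snd}.
  move=> [u v] [u' v']; rewrite !inE /= => uv uv' vv'; subst v'.
  by rewrite (edge_inj uv uv').
rewrite -(card_in_imset inj) -cardsT (cardsD1 (root T)) inE add1n; congr _.+1.
apply: eq_card => v; rewrite !inE andbT; apply/idP/imsetP.
  by move=> vr; exists (parent v, v); rewrite // inE edge_parent.
by case=> -[u w]; rewrite inE /= => uw ->; apply: edge_neq_root uw.
Qed.

Definition inner_nodes : {set node T} :=
  [set v | (v != root T) && ~~ is_leaf v].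

Lemma card_inner_nodes : 0 < #|edges T| ->
  #|inner_nodes| + #|leaves T| = #|edges T|.
Proof.
move=> N_gt0; apply/eqP; rewrite -eqSS -card_nodes; apply/eqP.
rewrite -(cardsC (leaves T)) addnC -addnS; congr (_ + _).
(* The root is among the non-leaves because an edge exists; removing it leaves the inner nodes and
   absorbs the extra one of [card_nodes]. *)
rewrite (cardsD1 (root T) (~: _)) !inE root_not_leaf // add1n.
by congr _.+1; apply: eq_card => v; rewrite !inE.
Qed.

(** * Extending a palindrome at both ends *)

Definition admissible : {set node T * node T} :=
  [set P | pal_path P.1 P.2 &&
           ((P.1 != P.2) || (P.1 != root T) && ~~ is_leaf P.2)].

Definition extends_by u v v' : bool :=
  edge v v' && palindrome (str (parent u) v').

Definition extendable : {set node T * node T} :=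
  [set P | [&& pal_path P.1 P.2, P.1 != root T
             & [exists v', extends_by P.1 P.2 v']]].

Definition long_pals : {set node T * node T} :=
  [set P | pal_path P.1 P.2 && (1 < size (str P.1 P.2))].

(** On [extendable] the [pick] succeeds and has a single candidate: the new last letter must equal
    the new first one, and labels out of [P.2] are distinct. *)
Definition extension (P : node T * node T) : node T * node T :=
  (parent P.1, odflt P.2 [pick v' | extends_by P.1 P.2 v']).

Lemma extensionP u v : (u, v) \in extendable ->
  exists2 v', extends_by u v v' & extension (u, v) = (parent u, v').
Proof.
rewrite inE /= => /and3P[_ _ /existsP[w xw]]; rewrite /extension /=.
by case: pickP => [v' xv'|/(_ w)]; [exists v' | rewrite xw].
Qed.

Lemma extension_inj : {in extendable &, injective extension}.
Proof.
move=> [u v] [u' v'] uvX uvX'.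
have [w /andP[vw _] ->] := extensionP uvX.
have [w' /andP[vw' _] ->] := extensionP uvX' => -[pu ww']; subst w'.
have vv' := edge_inj vw vw'; subst v'.
move: uvX uvX'; rewrite !inE /= => /and3P[/andP[uv _] ur _].
case/and3P=> /andP[uv' _] ur' _.
have [e e'] := (edge_parent ur, edge_parent ur').
rewrite (anc_inj uv uv') //.
(* Both extensions are the same path, so [str u v] and [str u' v] have equal length, as [anc_inj]
   requires. *)
have:= congr1 size (str_extend e uv vw).
rewrite pu (str_extend e' uv' vw) /= !size_rcons.
by case=> ->.
Qed.

Lemma extension_image : extension @: extendable = long_pals.
Proof.
apply/setP => -[x y]; apply/imsetP/idP => [[[u v] uvX ->]|].
  have [w /andP[vw pal_w] ->] := extensionP uvX.
  move: uvX; rewrite !inE /= => /and3P[/andP[uv _] ur _].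
  have e := edge_parent ur.
  rewrite /pal_path (anc_extend e uv vw) pal_w (str_extend e uv vw) /=.
  by rewrite size_rcons.
rewrite inE /= => /andP[/andP[xy pal_xy] s_gt1].
have [u [v [xu uv vy]]] := anc_size_gt1 xy s_gt1.
have:= pal_xy; rewrite (str_extend xu uv vy) palindrome_cons_rcons.
case/andP=> /eqP xu_vy pal_uv.
have uvX : (u, v) \in extendable.
  rewrite inE /= /pal_path uv pal_uv (edge_neq_root xu) /=.
  by apply/existsP; exists y; rewrite /extends_by vy (parentE xu).
(* The child [w] picked by [extension] is [y]: both edges out of [v] carry the label of the edge
   from [x] to [u]. *)
exists (u, v) => //; have [w /andP[vw]] := extensionP uvX.
rewrite (parentE xu) (str_extend xu uv vw) palindrome_cons_rcons.
by case/andP=> /eqP xu_vw _ ->; rewrite (label_inj vy vw) // -xu_vy.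
Qed.

(** * Maximal palindromes as a set difference, and the count *)

Lemma maximal_palindromesE : maximal_palindromes T = admissible :\: extendable.
Proof.
apply/setP => -[u v]; rewrite !inE /= /maximal_palindrome.
case: (pal_path u v) => //=.
have -> : [forall v', edge v v' ==> ~~ palindrome (str (parent u) v')]
        = ~~ [exists v', extends_by u v v'].
  by rewrite negb_exists; apply: eq_forallb => v'; rewrite negb_and implybE.
(* A path ending at a leaf cannot be extended below; with this, the equivalence is purely
   Boolean. *)
have leafF : is_leaf v -> [exists v', extends_by u v v'] = false.
  move=> /forallP lf; apply/existsP => -[v' /andP[vv' _]].
  by have:= lf v'; rewrite vv'.
case: (boolP (is_leaf v)) => [/leafF ->|_]; case: (u == v); case: (u == root T);
  by case: [exists v', extends_by u v v'].
Qed.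

Lemma extendable_sub : extendable \subset admissible.
Proof.
apply/subsetP => -[u v]; rewrite !inE /= => /and3P[-> -> /existsP[w /andP[vw _]]].
by apply/orP; right; apply/negP => /forallP/(_ w); rewrite vw.
Qed.

(** Paths are sorted by length: at least two, one (always a palindrome), or zero. *)
Lemma admissibleE :
  admissible = long_pals :|: (edges T :|: [set (v, v) | v in inner_nodes]).
Proof.
apply/setP => -[u v]; apply/idP/idP.
  rewrite !inE /= => /andP[/andP[uv pal] adm]; rewrite /pal_path uv pal /=.
  case: ltnP => //= /(anc_size_le1 uv)/orP[/eqP e|-> //]; subst v.
  rewrite eqxx /= in adm.
  by apply/orP; right; apply/imsetP; exists u; rewrite // inE.
case/setUP => [|/setUP[|/imsetP[w]]].
- rewrite !inE /= => /andP[-> s_gt1] /=; apply/orP; left.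
  by apply: contraTneq s_gt1 => ->; rewrite str_refl.
- rewrite !inE /= => uv; rewrite /pal_path /anc connect1 // (str_edge uv) /palindrome eqxx /=.
  apply/orP; left; apply/negP => /eqP e; subst v.
  by have:= str_refl u; rewrite (str_edge uv).
- rewrite inE => w_in [-> ->]; rewrite inE /= /pal_path /anc connect0 str_refl.
  by rewrite w_in orbT.
Qed.

Lemma card_admissible :
  #|admissible| = #|long_pals| + (#|edges T| + #|inner_nodes|).
Proof.
have size_loop P : P \in [set (v, v) | v in inner_nodes] -> size (str P.1 P.2) = 0.
  by case/imsetP=> v _ ->; rewrite str_refl.
have size_edge P : P \in edges T -> size (str P.1 P.2) = 1.
  by rewrite inE => /str_edge ->.
have card_loop : #|[set (v, v) | v in inner_nodes]| = #|inner_nodes|.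
  by rewrite card_imset // => u v [].
(* The three pieces are disjoint because their strings have different lengths. *)
rewrite admissibleE -card_loop !cardsU !disjoint_setI0 ?cards0 ?subn0 //.
  apply/pred0P => P /=; apply/negP => /andP[+ /setUP[/size_edge|/size_loop] s];
    by rewrite inE s andbF.
apply/pred0P => P /=; apply/negP => /andP[/size_edge s1 /size_loop].
by rewrite s1.
Qed.

Lemma card_maximal_palindromes :
  #|maximal_palindromes T| = #|edges T| + #|inner_nodes|.
Proof.
rewrite maximal_palindromesE cardsD (setIidPr extendable_sub) card_admissible.
by rewrite -extension_image (card_in_imset extension_inj) addKn.
Qed.

End Trie.

Theorem lemma3 (Sigma : eqType) (T : trie Sigma) (N L : nat)
  (hN : #|edges T| = N) (hL : #|leaves T| = L) (N_ge1 : 1 <= N) :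
  #|maximal_palindromes T| = 2 * N - L.
Proof.
rewrite -hN in N_ge1 *; rewrite card_maximal_palindromes mul2n -addnn.
(* Writing one of the two copies of [N] as inner nodes plus [L] makes the truncated subtraction
   exact. *)
by rewrite -{3}(card_inner_nodes N_ge1) hL addnA addnK.
Qed.
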